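(* Let $m$ and $e$ be positive real numbers satisfying $m\geq 1$ and $0<e\leq 2m+1$. Assume the sequence $\{p_n(x)\}_{n=0}^{\infty}$ of polynomials satisfies $p_n(x)=x^n$ for $n\in\{0,1,2\}$ and the recurrence $$p_n(x)=3x\,p_{n-1}(x)+\big((e-3)x^2-e\big)\,p_{n-2}(x)+\big((2m+1-e)x^3+(e-2m)x\big)\,p_{n-3}(x)\quad\text{for } n\geq 3.$$ Then all roots of all polynomials $p_n(x)$ are real. *)

(* Defs.v *)
From mathcomp Require Export all_boot all_order all_algebra.
From mathcomp Require Export reals.
From mathcomp.real_closed Require Export complex.

(* Main.v *)
From mathcomp Require Import ring lra zify polyrcf.
Require Import Defs.
Import Order.TTheory GRing.Theory Num.Theory.
Local Open Scope ring_scope.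

(** The recurrence has characteristic equation
      s^3 + (1 - x^2) (e s + 2 m x) = 0,   where s = t - x,
    which is homogeneous in x, t and the square root of 1 - x^2, and the initial
    values x^n agree with that grading.  Hence p_n(x) = x^n f_n(v) with
    v = (1 - x^2) / x^2, where f_0 = f_1 = f_2 = 1 and
      f_(n+3) = 3 f_(n+2) - (3 + e v) f_(n+1) + (1 + (e - 2 m) v) f_n.
    If every root of f_n is a positive real v, then every nonzero root x of p_n
    satisfies x^2 = 1 / (1 + v) > 0, so it is real.

    The polynomial f_n has degree floor((n-1)/2) and f_n(0) = 1.  Its roots are
    real and positive by a Sturm argument: it suffices that
      f_k(v) = 0 and v > 0 imply f_(k-1)(v) f_(k+1)(v) < 0.
    Given this, if f_n has all its roots real and positive and f_(n+1)
    alternates in sign on them, then f_(n+1) has a root between any two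
    consecutive ones, one before the first and, when its degree is larger, one
    after the last (interlacing_step); f_n alternates in sign on these new
    roots, and f_(n+2) takes there the signs opposite to those of f_n.

    The Sturm property (neighbours_of_zero) concerns a numerical sequence for
    one fixed v.  The characteristic roots of the recurrence are a real one,
    t = 1 - a with a^3 + e v a = 2 m v, and a conjugate pair with sum 2 + a and
    product T = 1 + a + S, where S = a^2 + e v.  Filtering out the pair gives
      f_(n+2) - (2 + a) f_(n+1) + T f_n = S t^n,
    so that f_k = 0 forces f_(k+1) = S t^(k-1) - T f_(k-1): the sign is the
    right one unless f_(k-1) is small compared with t^(k-1).  Filtering out t
    instead gives a two-term recurrence with a quadratic invariant that is
    multiplied by T at each step; since T > t^2, that invariant outgrows the
    contribution of t^n and excludes a small f_(k-1) (energy_bound).  As k is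
    at least 3, what has to be checked is the inequality
    S t^4 < a^2 T^2, and this is where e <= 2 m + 1 <= 3 m enters
    (real_root_dominated). *)

(** * The Sturm property at a point *)

(** Intermediate value theorem between 0 and 2 m / e, where the term e v a alone
    already reaches the right-hand side. *)
Lemma cubic_root (R : rcfType) (m e v : R) : 0 < m -> 0 < e -> 0 < v ->
  exists2 a, 0 < a & a ^+ 3 + e * v * a = 2 * m * v.
Proof.
move=> m0 e0 v0.
pose c : {poly R} := 'X^3 + (e * v) *: 'X - (2 * m * v)%:P.
have cE x : c.[x] = x ^+ 3 + e * v * x - 2 * m * v by rewrite /c !hornerE.
have b0 : 0 <= 2 * m / e by rewrite ltW // divr_gt0 // mulr_gt0.
have b3 : e * v * (2 * m / e) = 2 * m * v by field; rewrite gt_eqF.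
have [||a /andP[a0 _] /rootP] := @poly_ivt _ c 0 (2 * m / e) => //.
  rewrite !cE b3 addrK exprn_ge0 // andbT.
  have := mulr_gt0 m0 v0; nra.
rewrite cE => /eqP; rewrite subr_eq0 => /eqP aE.
exists a => //; rewrite lt_neqAle a0 andbT.
apply/eqP => a00; move: aE; rewrite -a00.
have := mulr_gt0 m0 v0; nra.
Qed.

(** The equation for a says that S (2 m - e a) = 2 m a^2.  For a >= 1/2 the
    inequality already follows from T > S > a^2 and (1 - a)^2 <= a^2.  For
    a < 1/2 the bound e <= 3 m keeps 2 m - e a away from 0, whence
    S (1 - 3a/2) <= a^2, and (1 - a)^4 < (1 - 3a/2) (1 + a)^2 concludes. *)
Lemma real_root_dominated (R : realFieldType) (m e a v S : R) :
    0 < m -> 0 < e -> e <= 3 * m -> 0 < a -> 0 < v ->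
    a ^+ 3 + e * v * a = 2 * m * v -> S = a ^+ 2 + e * v ->
  S * (1 - a) ^+ 4 < a ^+ 2 * (1 + a + S) ^+ 2.
Proof.
move=> m0 e0 em a0 v0 aE SE.
have ev0 : 0 < e * v by rewrite mulr_gt0.
have Sa : a ^+ 2 < S by rewrite SE ltrDl.
have S0 : 0 < S by apply: lt_trans Sa; rewrite exprn_gt0.
have [a2|a2] := lerP (1 / 2) a.
  have h1 : (1 - a) ^+ 4 <= a ^+ 4.
    have : 0 <= a ^+ 2 - (1 - a) ^+ 2 by nra.
    have : 0 <= a ^+ 2 + (1 - a) ^+ 2 by rewrite addr_ge0 ?sqr_ge0.
    move=> u w; rewrite -subr_ge0.
    have -> : a ^+ 4 - (1 - a) ^+ 4 =
      (a ^+ 2 - (1 - a) ^+ 2) * (a ^+ 2 + (1 - a) ^+ 2) by ring.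
    exact: mulr_ge0.
  have h2 : S * (1 - a) ^+ 4 <= S * a ^+ 4 by rewrite ler_pM2l.
  apply: le_lt_trans h2 _.
  have -> : S * a ^+ 4 = a ^+ 2 * (S * a ^+ 2) by ring.
  rewrite ltr_pM2l ?exprn_gt0 //.
  have h3 : S * a ^+ 2 < S * S by rewrite ltr_pM2l.
  apply: lt_trans h3 _; rewrite -expr2 ltr_pXn2r ?nnegrE //; lra.
have hS : S * (1 - 3 / 2 * a) <= a ^+ 2.
  have h : S * (2 * m - e * a) = 2 * m * a ^+ 2.
    have -> : 2 * m * a ^+ 2 =
      2 * m * a ^+ 2 + e * (2 * m * v - (a ^+ 3 + e * v * a)).
      by rewrite aE subrr mulr0 addr0.
    by rewrite SE; ring.
  have h' : S * (2 * m * (1 - 3 / 2 * a)) <= S * (2 * m - e * a).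
    by rewrite ler_pM2l //; nra.
  rewrite h in h'.
  have m2 : 0 < 2 * m by lra.
  rewrite -(ler_pM2l m2); lra.
have h1 : a ^+ 2 * (1 + a) ^+ 2 <= a ^+ 2 * (1 + a + S) ^+ 2.
  by rewrite ler_pM2l ?exprn_gt0 // ler_pXn2r ?nnegrE //; lra.
apply: lt_le_trans h1.
have h2 : S * (1 - 3 / 2 * a) * (1 + a) ^+ 2 <= a ^+ 2 * (1 + a) ^+ 2.
  by rewrite ler_pM2r // exprn_gt0 //; lra.
apply: lt_le_trans h2; rewrite -mulrA ltr_pM2l // -subr_gt0.
have -> : (1 - 3 / 2 * a) * (1 + a) ^+ 2 - (1 - a) ^+ 4 =
  a * (9 / 2 - 8 * a + 5 / 2 * a ^+ 2 - a ^+ 3) by field.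
apply: mulr_gt0 => //.
have := mulr_gt0 a0 a0; have : a ^+ 3 <= a ^+ 2 * 2^-1.
  by rewrite exprSr ler_pM2l ?exprn_gt0 //; lra.
nra.
Qed.

(** Here X and Y stand for f_(k+2) and t^(k+2), with f_(k+3) = 0, and the
    hypothesis on X and Y is the value of the quadratic invariant.  If the
    conclusion failed, then T X^2 <= S X Y, and the left-hand side of that
    hypothesis would be at most D S^2 Y^2; so T^(k+2) a^2 <= S t^(2k+4), against
    T > t^2 and S t^4 < a^2 T^2. *)
Lemma energy_bound (R : realFieldType) (a S T t D X Y : R) (k : nat) :
    0 < a -> a ^+ 2 < S -> t = 1 - a -> T = 1 + a + S -> D = S + 2 * a ^+ 2 ->
    S * t ^+ 4 < a ^+ 2 * T ^+ 2 -> Y = t ^+ k.+2 ->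
    (- (S * (t * Y))) ^+ 2 - (2 + a) * (D * X - S * Y) * - (S * (t * Y))
      + T * (D * X - S * Y) ^+ 2 = T ^+ k.+2 * (a ^+ 2 * S * D) ->
  X * (S * Y - T * X) < 0.
Proof.
move=> a0 Sa tE TE DE dom YE E; rewrite ltNge; apply/negP => bad.
have a20 : 0 < a ^+ 2 by rewrite exprn_gt0.
have S0 : 0 < S by apply: lt_trans Sa.
have D0 : 0 < D by rewrite DE; lra.
have T0 : 0 < T by rewrite TE; lra.
have tT : t ^+ 2 < T by rewrite tE TE; nra.
have TX : 0 <= T * X ^+ 2 by rewrite mulr_ge0 ?sqr_ge0 ?ltW.
have bad' : T * X ^+ 2 <= S * (X * Y).
  by rewrite -subr_ge0; move: bad; congr (_ <= _); ring.
have SXY : 0 <= S * (X * Y) by apply: le_trans bad'.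
(* The left-hand side of E is divisible by D = t^2 - (2 + a) t + T. *)
have E' : T ^+ k.+2 * (a ^+ 2 * S) =
    T * D * X ^+ 2 - S * (X * Y) * (3 * a + a ^+ 2 + 2 * S) + S ^+ 2 * Y ^+ 2.
  apply: (mulIf (lt0r_neq0 D0)).
  have -> : T ^+ k.+2 * (a ^+ 2 * S) * D = T ^+ k.+2 * (a ^+ 2 * S * D) by ring.
  by rewrite -E DE TE tE; ring.
have le1 : T * D * X ^+ 2 <= D * (S * (X * Y)).
  have -> : T * D * X ^+ 2 = D * (T * X ^+ 2) by ring.
  by rewrite ler_pM2l.
have le2 : T ^+ k.+2 * (a ^+ 2 * S) <= S ^+ 2 * Y ^+ 2.
  have h : 0 <= S * (X * Y) * (3 * a + S - a ^+ 2).
    by rewrite mulr_ge0 //; lra.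
  rewrite E' -subr_ge0.
  have -> : S ^+ 2 * Y ^+ 2
      - (T * D * X ^+ 2 - S * (X * Y) * (3 * a + a ^+ 2 + 2 * S) + S ^+ 2 * Y ^+ 2)
    = (D * (S * (X * Y)) - T * D * X ^+ 2) + S * (X * Y) * (3 * a + S - a ^+ 2).
    by rewrite DE; ring.
  by rewrite addr_ge0 // subr_ge0.
have {}le2 : T ^+ k.+2 * a ^+ 2 <= S * Y ^+ 2.
  rewrite -(ler_pM2l S0); move: le2; congr (_ <= _); ring.
have Yk : Y ^+ 2 = t ^+ 4 * (t ^+ 2) ^+ k.
  rewrite YE -addn2 exprD exprMn [(t ^+ k) ^+ 2]exprAC.
  by rewrite -[(t ^+ 2) ^+ 2]exprM mulrC.
have Tk : T ^+ k.+2 = T ^+ 2 * T ^+ k by rewrite -exprD.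
have le3 : (t ^+ 2) ^+ k <= T ^+ k.
  by rewrite lerXn2r ?nnegrE ?sqr_ge0 ?ltW.
have lt4 : S * t ^+ 4 * T ^+ k < a ^+ 2 * T ^+ 2 * T ^+ k.
  by rewrite ltr_pM2r ?exprn_gt0.
have le5 : S * t ^+ 4 * (t ^+ 2) ^+ k <= S * t ^+ 4 * T ^+ k.
  by rewrite ler_wpM2l // mulr_ge0 ?exprn_even_ge0 // ltW.
move: le2; rewrite Yk Tk leNgt => /negP; apply.
rewrite [S * (_ * _)]mulrA; apply: le_lt_trans le5 _.
by rewrite [_ * a ^+ 2]mulrC [a ^+ 2 * (_ * _)]mulrA.
Qed.

(** Removing the pair of conjugate roots expresses the value after a zero by the
    value before it; energy_bound then decides its sign. *)
Lemma neighbours_of_zero (R : rcfType) (m e v : R) (u : nat -> R) :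
    0 < m -> 0 < e -> e <= 3 * m -> 0 < v ->
    u 0 = 1 -> u 1 = 1 -> u 2 = 1 ->
    (forall n, u n.+3 = 3 * u n.+2 - (3 + e * v) * u n.+1
                        + (1 + (e - 2 * m) * v) * u n) ->
  forall k, u k.+1 = 0 -> u k * u k.+2 < 0.
Proof.
move=> m0 e0 em v0 u0 u1 u2 uS k uk.
have [a a0 aE] := @cubic_root _ m e v m0 e0 v0.
pose S := a ^+ 2 + e * v.
have dom := @real_root_dominated _ m e a v S m0 e0 em a0 v0 aE erefl.
have ev0 : 0 < e * v by rewrite mulr_gt0.
have Sa : a ^+ 2 < S by rewrite /S ltrDl.
pose t := 1 - a; pose T := 1 + a + S; pose D := S + 2 * a ^+ 2.
have uE n : u n.+2 = (2 + a) * u n.+1 - T * u n + S * t ^+ n.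
  elim: n => [|n IH]; first by rewrite u0 u1 u2 /T expr0; ring.
  have St : S * t ^+ n.+1 = t * (u n.+2 - (2 + a) * u n.+1 + T * u n).
    by rewrite IH exprS; ring.
  rewrite uS St.
  have -> : (1 + (e - 2 * m) * v) = 1 + e * v - 2 * m * v by ring.
  by rewrite -aE /t /T /S; ring.
(* D times the component of u along the pair of conjugate roots:
   S t^n / D is the component along t. *)
pose U n := D * u n - S * t ^+ n.
have US n : U n.+2 = (2 + a) * U n.+1 - T * U n.
  by rewrite /U uE !exprS /D /t /T; ring.
have En n : U n.+1 ^+ 2 - (2 + a) * U n * U n.+1 + T * U n ^+ 2
    = T ^+ n * (a ^+ 2 * S * D).
  elim: n => [|n IH].
    by rewrite /U u0 u1 /D /t /T; ring.
  by rewrite [T ^+ n.+1]exprS -[in RHS]mulrA -IH US; ring.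
(* Two steps of the invariant precede any zero, as the bound on t^4 requires. *)
have k2 : (2 <= k)%N.
  by move: uk; case: (k) => [|[|j]] // /eqP; rewrite ?u1 ?u2 oner_eq0.
case: k k2 uk => [|[|k]] // _ uk.
have := En k.+2; rewrite /U uk mulr0 sub0r [t ^+ k.+3]exprS => E.
rewrite [u k.+4]uE uk mulr0 sub0r addrC.
by apply: (@energy_bound _ a S T t D _ (t ^+ k.+2) k).
Qed.

(** * Interlacing of positive roots *)

Lemma prod_sign (R : realDomainType) (g : nat -> R) (j d : nat) :
    (j <= d)%N -> (forall i, (i < j)%N -> g i < 0) ->
    (forall i, (j <= i < d)%N -> 0 < g i) ->
  0 < (-1) ^+ j * \prod_(i < d) g i.
Proof.
elim: d j => [|d IH] j jd gN gP.
  by move: jd; rewrite leqn0 => /eqP ->; rewrite big_ord0 expr0 mulr1.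
rewrite big_ord_recr /= mulrA.
move: jd; rewrite leq_eqVlt => /predU1P[jE|jd].
  rewrite jE exprS mulN1r mulNr mulNr -mulrN mulr_gt0 ?oppr_gt0 ?gN ?jE //.
  apply: IH => // i; first by move=> id; apply: gN; rewrite jE ltnS ltnW.
  by case/andP=> di /leq_trans/(_ di); rewrite ltnn.
apply: mulr_gt0; last by apply: gP; rewrite ltnSn andbT.
apply: IH => // i /andP[ji id].
by apply: gP; rewrite ji ltnS ltnW.
Qed.

(** When p has degree d these are all its roots.  A sequence on nat spares the
    casts between ordinals that shifting indices would need. *)
Definition positive_roots {R : realFieldType} (p : {poly R}) (d : nat)
    (r : nat -> R) : Prop :=
  (forall i, (i < d)%N -> 0 < r i /\ root p (r i)) /\
  (forall i j, (i < j)%N -> (j < d)%N -> r i < r j).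

Lemma positive_roots_factor (R : realFieldType) (p : {poly R}) d r :
    size p = d.+1 -> positive_roots p d r ->
  p = lead_coef p *: \prod_(i < d) ('X - (r i)%:P).
Proof.
move=> sp [rP rI].
rewrite {1}(@all_roots_prod_XsubC _ p (mkseq r d)) ?size_mkseq //.
- by rewrite big_map -[in iota _ _](subn0 d) big_mkord.
- apply/(all_nthP 0) => i; rewrite size_mkseq => id.
  by rewrite nth_mkseq //; case: (rP i id).
rewrite uniq_rootsE; apply/mkseq_uniqP => i j; rewrite !inE => id jd rij.
case: (ltngtP i j) => // [/rI/(_ jd)|/rI/(_ id)]; by rewrite rij ltxx.
Qed.

(** The product p(y) p(0) is a positive constant times the product of the
    (y - r i) (0 - r i), whose negative factors are those with i < j;
    multiplying by p(0) turns the leading coefficient of p into its square. *)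
Lemma positive_roots_sign (R : realFieldType) (p : {poly R}) d r j y :
    size p = d.+1 -> positive_roots p d r -> 0 < p.[0] -> (j <= d)%N ->
    (forall i, (i < j)%N -> r i < y) ->
    (forall i, (j <= i < d)%N -> y < r i) ->
  0 < (-1) ^+ j * p.[y].
Proof.
move=> sp pr p0 jd ry yr.
have pE := @positive_roots_factor _ _ _ _ sp pr.
have c0 : lead_coef p != 0 by rewrite lead_coef_eq0 -size_poly_eq0 sp.
have hE x : p.[x] = lead_coef p * \prod_(i < d) (x - r i).
  rewrite {1}pE hornerZ horner_prod; congr (_ * _).
  by apply: eq_bigr => i _; rewrite !hornerE.
rewrite -(pmulr_lgt0 _ p0) !hE.
have -> : (-1) ^+ j * (lead_coef p * \prod_(i < d) (y - r i)) *
    (lead_coef p * \prod_(i < d) (0 - r i)) =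
    lead_coef p ^+ 2 * ((-1) ^+ j * \prod_(i < d) ((y - r i) * (0 - r i))).
  by rewrite big_split /=; ring.
rewrite mulr_gt0 ?lt0r ?sqr_ge0 ?sqrf_eq0 ?c0 // -lt0r.
have rpos i : (i < d)%N -> 0 - r i < 0 by case: pr => rP _ /rP[? _]; lra.
apply: (@prod_sign _ (fun i => (y - r i) * (0 - r i))) => // i.
  by move=> ij; rewrite nmulr_llt0 ?rpos ?subr_gt0 ?ry //; apply: leq_trans jd.
move=> ijd; have /andP[_ id] := ijd.
by rewrite nmulr_lgt0 ?rpos // subr_lt0 yr.
Qed.

(** By the sign conditions, q alternates in sign along 0, the roots of p, and,
    when d' = d + 1, a point beyond them where q has the sign of its leading
    term.  The intermediate value theorem places a root of q in each gap, hence
    the signs of p at these roots. *)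
Lemma interlacing_step (R : rcfType) (p q : {poly R}) d d' r :
    size p = d.+1 -> positive_roots p d r -> 0 < p.[0] -> 0 < q.[0] ->
    0 < (-1) ^+ d' * lead_coef q -> (d <= d' <= d.+1)%N ->
    (forall i, (i < d)%N -> 0 < (-1) ^+ i.+1 * q.[r i]) ->
  exists2 s, positive_roots q d' s &
    forall i, (i < d')%N -> 0 < (-1) ^+ i * p.[s i].
Proof.
move=> sp pr p0 q0 lq /andP[dd' d'd] qr.
have [rP rI] := pr.
have [M0 M0P] : exists M0, forall x, M0 <= x -> 0 < (-1) ^+ d' * q.[x].
  have := @poly_pinfty_gt_lc _ ((-1) ^+ d' *: q).
  rewrite lead_coefZ => /(_ lq)[M0 MP]; exists M0 => x /MP.
  by rewrite hornerZ; apply: lt_le_trans.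
pose M := Num.max M0 (Num.max 1 (r d.-1 + 1)).
have MM0 : M0 <= M by rewrite /M le_max lexx.
have M_gt0 : 0 < M by rewrite /M !lt_max ltr01 orbT.
have rM : r d.-1 < M by rewrite /M !lt_max ltrDl ltr01 !orbT.
pose x i := if i is k.+1 then (if (k < d)%N then r k else M) else 0.
have xS i : (i < d')%N -> x i < x i.+1.
  case: i => [_|i id'] /=.
    by case: ifP => // /rP[].
  have id : (i < d)%N by lia.
  rewrite id; case: ifP => [id1|nid1]; first exact: rI.
  by have -> : i = d.-1 by lia.
have xq i : (i <= d')%N -> 0 < (-1) ^+ i * q.[x i].
  case: i => [_|i id'] /=; first by rewrite expr0 mul1r.
  case: ifP => [/qr //|nid].
  have -> : i.+1 = d' by lia.
  exact: M0P.
have xle i j : (i <= j)%N -> (j <= d')%N -> x i <= x j.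
  elim: j => [|j IH]; first by rewrite leqn0 => /eqP ->.
  rewrite leq_eqVlt => /predU1P[-> //|ij] jd'.
  by apply: le_trans (IH ij (ltnW jd')) (ltW (xS _ jd')).
have sP i : exists s, (i < d')%N ==> [&& x i < s, s < x i.+1 & root q s].
  have [id'|nid'] := ltnP i d'; last by exists 0.
  have [|s] := @poly_ivtoo _ q (x i) (x i.+1) (ltW (xS i id')).
    have := mulr_gt0 (xq i (ltnW id')) (xq i.+1 id').
    have -> : (-1) ^+ i * q.[x i] * ((-1) ^+ i.+1 * q.[x i.+1]) =
      - (((-1) ^+ i) ^+ 2 * (q.[x i] * q.[x i.+1])) by rewrite exprS; ring.
    by rewrite sqrr_sign mul1r oppr_gt0.
  by rewrite in_itv /= => /andP[xs sx] qs; exists s; rewrite xs sx.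
pose s i := xchoose (sP i).
have sE i : (i < d')%N -> [/\ x i < s i, s i < x i.+1 & root q (s i)].
  by move=> id'; have /implyP/(_ id')/and3P[] := xchooseP (sP i).
exists s.
  split=> [i id'|i j ij jd'].
    have [xs _ ->] := sE i id'; split=> //; apply: le_lt_trans xs.
    exact: (xle 0 i (leq0n i) (ltnW id')).
  have [_ sx _] := sE i (ltn_trans ij jd'); have [xs _ _] := sE j jd'.
  by apply: lt_trans sx (le_lt_trans (xle _ _ ij (ltnW jd')) xs).
move=> i id'; have [xs sx _] := sE i id'.
apply: (@positive_roots_sign _ p d r) => //; first by lia.
  move=> k ki; apply: le_lt_trans xs.
  have := xle k.+1 i ki (ltnW id'); rewrite /= ifT //; lia.
move=> k /andP[ik kd]; apply: lt_le_trans sx _.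
by have := xle i.+1 k.+1 ik (leq_trans kd dd'); rewrite /= kd.
Qed.

(** * The dehomogenised sequence *)

(** The polynomials f_n; their variable v = (1 - x^2) / x^2 is the square of the
    tangent of theta when x = cos theta. *)
Fixpoint tan2_poly {R : realFieldType} (m e : R) (n : nat) : {poly R} :=
  if n is ((n0.+1 as n1).+1 as n2).+1 then
    3 *: tan2_poly m e n2 - (3%:P + e *: 'X) * tan2_poly m e n1
      + (1 + (e - 2 * m) *: 'X) * tan2_poly m e n0
  else 1.

Lemma tan2_polyS (R : realFieldType) (m e : R) n :
  tan2_poly m e n.+3 = 3 *: tan2_poly m e n.+2
    - (3%:P + e *: 'X) * tan2_poly m e n.+1
    + (1 + (e - 2 * m) *: 'X) * tan2_poly m e n.
Proof. by []. Qed.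

Lemma horner_tan2_polyS (R : realFieldType) (m e v : R) n :
  (tan2_poly m e n.+3).[v] = 3 * (tan2_poly m e n.+2).[v]
    - (3 + e * v) * (tan2_poly m e n.+1).[v]
    + (1 + (e - 2 * m) * v) * (tan2_poly m e n).[v].
Proof. by rewrite tan2_polyS !hornerE. Qed.

Lemma horner0_tan2_poly (R : realFieldType) (m e : R) n :
  (tan2_poly m e n).[0] = 1.
Proof.
elim/ltn_ind: n => -[|[|[|n]]] IH; try by rewrite /= hornerC.
by rewrite horner_tan2_polyS !IH; [ring | lia..].
Qed.

Lemma coef_tan2_polyS (R : realFieldType) (m e : R) n j :
  (tan2_poly m e n.+3)`_j.+1 = 3 * (tan2_poly m e n.+2)`_j.+1
    - (3 * (tan2_poly m e n.+1)`_j.+1 + e * (tan2_poly m e n.+1)`_j)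
    + ((tan2_poly m e n)`_j.+1 + (e - 2 * m) * (tan2_poly m e n)`_j).
Proof.
rewrite tan2_polyS !mulrDl mul1r -!scalerAl.
rewrite !(coefD, coefN, coefZ, coefCM, coefXM).
by rewrite /=; ring.
Qed.

(** Degrees and leading signs: the index 2k+2 gives degree k, and the indices
    2k+3 and 2k+4 give degree k+1, their coefficients of that degree having the
    sign of (-1)^(k+1).  In the recurrence for 2k+6 the two odd-indexed
    contributions combine to 3 e - (e - 2 m) = 2 (e + m) > 0. *)
Lemma tan2_poly_coefs (R : realFieldType) (m e : R) k : 0 < m -> 0 < e ->
  [/\ forall j, (k < j)%N -> (tan2_poly m e k.*2.+2)`_j = 0,
      forall j, (k.+1 < j)%N ->
        (tan2_poly m e k.*2.+3)`_j = 0 /\ (tan2_poly m e k.*2.+4)`_j = 0,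
      0 < (-1) ^+ k.+1 * (tan2_poly m e k.*2.+3)`_k.+1 &
      0 < (-1) ^+ k.+1 * (tan2_poly m e k.*2.+4)`_k.+1].
Proof.
move=> m0 e0; elim: k => [|k [IH2 IH34 IH3 IH4]].
  split=> [[|j]|[|[|j]]||] //.
  - by rewrite coef1.
  - by rewrite !(coef_tan2_polyS _ m e) /= !coef1 /=; split; ring.
  - by rewrite !(coef_tan2_polyS _ m e) /= !coef1 /=; lra.
  - by rewrite !(coef_tan2_polyS _ m e) /= !coef1 /=; lra.
have c5 j : (k < j)%N ->
    (tan2_poly m e k.*2.+4.+1)`_j.+1 = - e * (tan2_poly m e k.*2.+3)`_j.
  move=> kj; rewrite coef_tan2_polyS.
  by rewrite (IH34 j.+1 _).1 // (IH34 j.+1 _).2 // !IH2 //; [ring | lia].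
have c6 j : (k < j)%N -> (tan2_poly m e k.*2.+4.+2)`_j.+1 =
   - (2 * e + 2 * m) * (tan2_poly m e k.*2.+3)`_j - e * (tan2_poly m e k.*2.+4)`_j.
  move=> kj; rewrite coef_tan2_polyS c5 //.
  by rewrite (IH34 j.+1 _).1 // (IH34 j.+1 _).2 //; ring.
rewrite doubleS; split.
- by move=> j kj; rewrite (IH34 j kj).2.
- move=> [//|j] kj; rewrite c5 ?c6; try lia.
  by have [-> ->] := IH34 j kj; split; ring.
- rewrite c5 // [_ ^+ _.+2]exprS; have := mulr_gt0 e0 IH3; nra.
- rewrite c6 // [_ ^+ _.+2]exprS.
  have := mulr_gt0 e0 IH3; have := mulr_gt0 m0 IH3.
  have := mulr_gt0 e0 IH4; nra.
Qed.

Lemma size_tan2_poly (R : realFieldType) (m e : R) n : 0 < m -> 0 < e ->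
  size (tan2_poly m e n) = (n.-1./2).+1 /\
  0 < (-1) ^+ (n.-1./2) * lead_coef (tan2_poly m e n).
Proof.
move=> m0 e0.
have gen (p : {poly R}) d : (forall j, (d < j)%N -> p`_j = 0) ->
    0 < (-1) ^+ d * p`_d -> size p = d.+1 /\ 0 < (-1) ^+ d * lead_coef p.
  move=> p0 pd.
  have sp : size p = d.+1.
    apply/eqP; rewrite eqn_leq; apply/andP; split; first exact/leq_sizeP.
    rewrite ltnNge; apply/negP => /leq_sizeP/(_ d (leqnn _)) pd0.
    by move: pd; rewrite pd0 mulr0 ltxx.
  by split=> //; rewrite /lead_coef sp.
case: n => [|[|[|n]]]; try by apply: gen => [[|j]|]; rewrite coef1 // mulr1.
have [k nE] : exists k, n = k.*2 \/ n = k.*2.+1 by exists n./2; lia.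
have [_ c34 c3 c4] := @tan2_poly_coefs R m e k m0 e0.
have -> : n.+3.-1./2 = k.+1 by lia.
by case: nE => ->; apply: gen => // j /c34[].
Qed.

(** The induction carries the sign alternation of the next polynomial, which is
    what interlacing_step consumes; the Sturm property turns the alternation of
    f_n on the roots of f_(n+1) into that of f_(n+2). *)
Lemma tan2_poly_roots (R : rcfType) (m e : R) n : 0 < m -> 0 < e -> e <= 3 * m ->
  exists2 r, positive_roots (tan2_poly m e n) n.-1./2 r &
    forall i, (i < n.-1./2)%N -> 0 < (-1) ^+ i.+1 * (tan2_poly m e n.+1).[r i].
Proof.
move=> m0 e0 em; elim: n => [|n [r rP rs]]; first by exists (fun=> 0).
have [sn _] := @size_tan2_poly R m e n m0 e0.
have [_ ln1] := @size_tan2_poly R m e n.+1 m0 e0.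
have [||||s sP ss] := @interlacing_step R _ (tan2_poly m e n.+1) _ _ r sn rP _ _ ln1.
- by rewrite horner0_tan2_poly.
- by rewrite horner0_tan2_poly.
- by lia.
- exact: rs.
exists s => // i id.
have [s0 /rootP sn1] := sP.1 i id.
have := @neighbours_of_zero R m e (s i) (fun k => (tan2_poly m e k).[s i])
  m0 e0 em s0.
move=> /(_ _ _ _ _ n sn1); rewrite !hornerC => /(_ erefl erefl erefl).
move=> /(_ (fun k => horner_tan2_polyS R m e (s i) k)) neg.
have [si] := ss i id.
rewrite exprS; nra.
Qed.

(** * Back to the original polynomials *)

(** The dehomogenisation p_n(z) = z^n f_n((1 - z^2) / z^2), over any extension
    field, since it is needed at complex points. *)
Lemma horner_map_tan2_poly (R : realFieldType) (K : fieldType)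
    (F : {rmorphism R -> K}) (m e : R) (p : nat -> {poly R}) (z : K) :
    (forall n : nat, (n <= 2)%N -> p n = 'X^n) ->
    (forall n : nat, (3 <= n)%N ->
      p n = 3 *: 'X * p (n - 1)%N
        + ((e - 3) *: 'X^2 - e%:P) * p (n - 2)%N
        + ((2 * m + 1 - e) *: 'X^3 + (e - 2 * m) *: 'X) * p (n - 3)%N) ->
    z != 0 ->
  forall n, (map_poly F (p n)).[z] =
    z ^+ n * (map_poly F (tan2_poly m e n)).[(1 - z ^+ 2) / z ^+ 2].
Proof.
move=> p_init p_rec z0; elim/ltn_ind => n IH.
have [n2|n3] := leqP n 2.
  rewrite p_init // map_polyXn hornerXn.
  by move: n2 {IH}; case: n => [|[|[|]]] // _; rewrite /= rmorph1 hornerC mulr1.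
case: n n3 IH => [|[|[|n]]] // _ IH.
pose ev x q := (map_poly F q).[x].
have evp (c1 c2 c3 c4 c5 : R) (a b c : {poly R}) :
    ev z (c1 *: 'X * a + (c2 *: 'X^2 - c3%:P) * b + (c4 *: 'X^3 + c5 *: 'X) * c) =
    F c1 * z * ev z a + (F c2 * z ^+ 2 - F c3) * ev z b
      + (F c4 * z ^+ 3 + F c5 * z) * ev z c.
  rewrite /ev !(rmorphD, rmorphM, rmorphN) /= !map_polyZ !map_polyXn map_polyX.
  by rewrite map_polyC /= !(hornerE, hornerXn).
have evd w (c1 c2 c3 c4 : R) (a b c : {poly R}) :
    ev w (c1 *: a - (c2%:P + c3 *: 'X) * b + (1 + c4 *: 'X) * c) =
    F c1 * ev w a - (F c2 + F c3 * w) * ev w b + (1 + F c4 * w) * ev w c.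
  rewrite /ev !(rmorphD, rmorphM, rmorphN) /= !map_polyZ map_polyX rmorph1.
  by rewrite map_polyC /= !hornerE.
rewrite -!/(ev _ _) p_rec // tan2_polyS !subSS !subn0 evp evd /ev.
rewrite !IH //; try lia.
move: (_.[_]) (_.[_]) (_.[_]) => A B C.
by rewrite !exprS; field.
Qed.

Lemma real_of_sqr_gt0 (R : rcfType) (z : R[i]) (t : R) :
  0 < t -> z ^+ 2 = t%:C%C -> z \is Num.real.
Proof.
move=> t0 zt.
have : (z - (Num.sqrt t)%:C%C) * (z + (Num.sqrt t)%:C%C) = 0.
  by rewrite -subr_sqr zt -rmorphXn sqr_sqrtr ?subrr ?ltW.
have sr : (Num.sqrt t)%:C%C \is Num.real by rewrite complex_real.
move/eqP; rewrite mulf_eq0 subr_eq0 addr_eq0 => /orP[] /eqP ->//.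
by rewrite rpredN.
Qed.

Theorem theorem7p1 (R : realType) (m e : R) (p : nat -> {poly R})
  (hm0 : 0 < m) (he0 : 0 < e)
  (hm : 1 <= m) (he : e <= 2 * m + 1)
  (hp_init : forall n : nat, (n <= 2)%N -> p n = 'X^n)
  (hp_rec : forall n : nat, (3 <= n)%N ->
    p n = 3 *: 'X * p (n - 1)%N
        + ((e - 3) *: 'X^2 - e%:P) * p (n - 2)%N
        + ((2 * m + 1 - e) *: 'X^3 + (e - 2 * m) *: 'X) * p (n - 3)%N) :
  forall (n : nat) (z : R[i]),
    root (map_poly (real_complex R) (p n)) z -> z \is Num.real.
Proof.
move=> n z /rootP.
have [->|z0] := eqVneq z 0; first by rewrite real0.
rewrite (@horner_map_tan2_poly R _ (real_complex R) m e p z hp_init hp_rec z0).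
move/eqP; rewrite mulf_eq0 expf_eq0 (negbTE z0) andbF /=.
have em : e <= 3 * m by lra.
have [r rP _] := @tan2_poly_roots R m e n hm0 he0 em.
have [sn _] := @size_tan2_poly R m e n hm0 he0.
rewrite (@positive_roots_factor _ _ _ _ sn rP) map_polyZ rmorph_prod.
rewrite hornerZ horner_prod.
rewrite mulf_eq0 fmorph_eq0 lead_coef_eq0 -size_poly_eq0 sn /=.
move=> /prodf_eq0[i _]; rewrite map_polyXsubC hornerXsubC subr_eq0 => /eqP zr.
have [ri0 _] := rP.1 i (ltn_ord i).
apply: (@real_of_sqr_gt0 _ z (1 + r i)^-1); first by rewrite invr_gt0; lra.
have z20 : z ^+ 2 != 0 by rewrite expf_neq0.
have zE : z ^+ 2 * (1 + r i)%:C%C = 1.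
  by rewrite rmorphD rmorph1 /= -[(r i)%:C%C]zr; field.
have r1 : (1 + r i)%:C%C != 0 by rewrite fmorph_eq0 gt_eqF //; lra.
by apply: (mulIf r1); rewrite zE fmorphV mulVf.
Qed.
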